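(* Let $\Omega\subseteq\mathbb{R}^n$ be open with $\Omega\cap\Sigma\neq\emptyset$. For each $f\in\mathcal{D}'_{\ast,\Sigma}(\Omega)$ and each multi-index $\alpha\in\mathbb{N}^n$ (entries non-negative integers), $$\Pi\left(\frac{\partial_\ast^\alpha f}{\partial x^\alpha}\right)=\frac{\bar\partial^\alpha\Pi(f)}{\partial x^\alpha}.$$ Furthermore, if $\psi\in\mathcal{E}_{\ast,\Sigma}(\Omega)$, then $$\frac{\partial_\ast^\alpha(\psi f)}{\partial x^\alpha}=\sum_{\beta\le\alpha}\binom{\alpha}{\beta}\frac{\partial^\beta\psi}{\partial x^\beta}\,\frac{\partial_\ast^{\alpha-\beta}f}{\partial x^{\alpha-\beta}}.$$
   Context: $\Sigma\subset\mathbb{R}^n$ is a (boundaryless) closed smooth submanifold of codimension $d\geq 1$, not assumed orientable; $N_\xi(\Sigma)$ is its normal space at $\xi\in\Sigma$. Fix a continuous $\epsilon:\Sigma\to(0,\infty)$ such that on the open set $\Sigma^{\epsilon}=\{x\in\mathbb{R}^n:\ \|x-\xi\|<\epsilon(\xi)\text{ for some }\xi\in\Sigma\}$ every $x$ has a unique closest point $\pi(x)\in\Sigma$ and $\pi:\Sigma^\epsilon\to\Sigma$ is a smooth submersion (tubular neighborhood theorem). Fix a family $\{U_\nu\}_{\nu\in\mathbb{N}}$ of bounded open subsets of $\Sigma^{\epsilon}$ such that $\{\Sigma\cap U_\nu\}_\nu$ is an open covering of $\Sigma$ and, for each $\nu$: (i) $U_\nu\cap\Sigma\neq\emptyset$;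 (ii) there are smooth vector fields $\mathbf{n}^\nu_j:U_\nu\cap\Sigma\to\mathbb{S}^{n-1}$, $j=1,\dots,d$, forming an orthonormal basis of $N_\xi(\Sigma)$ at each $\xi\in U_\nu\cap\Sigma$; (iii) there is $\rho_\nu>0$ such that $(\xi,\omega,\rho)\mapsto\xi+\rho\sum_{j=1}^d\omega_j\mathbf{n}^\nu_j(\xi)$ is a diffeomorphism from $(\Sigma\cap U_\nu)\times\mathbb{S}^{d-1}\times(0,\rho_\nu)$ onto $U_\nu\setminus\Sigma$. For $x\in U_\nu\setminus\Sigma$, $(\xi_x,\omega_x,\rho_x)$ denotes the image of $x$ under the inverse of this diffeomorphism; explicitly $\xi_x=\pi(x)$, $\rho_x=\|x-\pi(x)\|$, $\omega_{x,k}=\mathbf{n}^\nu_k(\pi(x))\cdot(x-\pi(x))/\|x-\pi(x)\|$. $K\Subset\Omega$ means that $K$ is a compact subset of the interior of $\Omega$. An asymptotic expansion $b(x)\sim\sum_j c_j(x)$ of smooth functions is called strong if it may be differentiated termwise: for each multi-index $\alpha$, $\partial^\alpha b\sim\sum_j\partial^\alpha c_j$ (here: for each $\alpha$ and each $q$, for all sufficiently large $N$ the difference of $\partial^\alpha b$ and $\sum_{j\le N}\partial^\alpha c_j$ is $O(\rho_x^q)$ as $\rho_x\to0$, uniformly). For $\Omega\subseteq\mathbb{R}^n$ open with $\Omega\cap\Sigma\ne\emptyset$, $m\in\mathbb{Z}$ and $K\Subset\Omega$, $\mathcal{D}^{[m;K]}_{\ast,\Sigma}(\Omega)$ is the space of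 all $\phi\in C^\infty(\Omega\setminus\Sigma)$ vanishing outside $K$ such that on each nonempty $\Omega\cap U_\nu\setminus\Sigma$ the function $\phi$ admits a (uniform) strong asymptotic expansion $\phi(x)\sim\sum_{j=m}^\infty a_j(\xi_x,\omega_x)\rho_x^j$ as $\rho_x\to0$, with some $a_j=a_j^{\phi,\nu}\in C^\infty((\Sigma\cap U_\nu)\times\mathbb{S}^{d-1})$. For such $\phi$ and each $\alpha$ one has $\partial^\alpha\phi/\partial x^\alpha\sim\sum_{j=m-|\alpha|}^\infty a_{j,\alpha}(\xi_x,\omega_x)\rho_x^j$ with smooth coefficients $a_{j,\alpha}=a_{j,\alpha}^{\phi,\nu}$ on $(\Sigma\cap U_\nu)\times\mathbb{S}^{d-1}$. Topology: put $U=\bigcup_\nu U_\nu$. $\mathcal{D}^{[m;K]}_{\ast,\Sigma}(\Omega)$ is a Fréchet space with the seminorms, for $q>m$ and $k,\nu\in\mathbb{N}$, $$\|\phi\|_{q,k,\nu,K,m}=\sup_{|\alpha|\le k,\ x\in K\cap U_\nu\setminus\Sigma}\rho_x^{-q}\Big|\frac{\partial^\alpha\phi}{\partial x^\alpha}(x)-\sum_{j=m-|\alpha|}^{q-1}a_{j,\alpha}(\xi_x,\omega_x)\rho_x^j\Big|+\sup_{|\alpha|\le k,\ x\in K\setminus U}\Big|\frac{\partial^\alpha\phi}{\partial x^\alpha}(x)\Big|.$$ $\mathcal{D}_{\ast,\Sigma}(\Omega)=\bigcup_{K\Subset\Omega,\,m\in\mathbb{Z}}\mathcal{D}^{[m;K]}_{\ast,\Sigma}(\Omega)$,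 with the (strict) inductive limit topology; partial derivatives act continuously on it, and $\mathcal{D}(\Omega)$ is a closed subspace of it (restricting test functions to $\Omega\setminus\Sigma$). $\mathcal{E}_{\ast,\Sigma}(\Omega)$ is the space of all $\psi\in C^\infty(\Omega\setminus\Sigma)$ with $\varphi\psi\in\mathcal{D}_{\ast,\Sigma}(\Omega)$ for every $\varphi\in\mathcal{D}(\Omega)$; it is closed under differentiation, and multiplication by $\psi\in\mathcal{E}_{\ast,\Sigma}(\Omega)$ is a continuous operator on $\mathcal{D}_{\ast,\Sigma}(\Omega)$. $\mathcal{D}'_{\ast,\Sigma}(\Omega)$ is the (strong) dual of $\mathcal{D}_{\ast,\Sigma}(\Omega)$. For $f\in\mathcal{D}'_{\ast,\Sigma}(\Omega)$ and $\phi\in\mathcal{D}_{\ast,\Sigma}(\Omega)$: $\langle\partial_\ast^\alpha f/\partial x^\alpha,\phi\rangle=(-1)^{|\alpha|}\langle f,\partial^\alpha\phi/\partial x^\alpha\rangle$ and $\langle\psi f,\phi\rangle=\langle f,\psi\phi\rangle$ for $\psi\in\mathcal{E}_{\ast,\Sigma}(\Omega)$. $\Pi:\mathcal{D}'_{\ast,\Sigma}(\Omega)\to\mathcal{D}'(\Omega)$ is the transpose of the inclusion $\mathcal{D}(\Omega)\to\mathcal{D}_{\ast,\Sigma}(\Omega)$. $\bar\partial^\alpha/\partial x^\alpha$ is the usual distributional derivative on $\mathcal{D}'(\Omega)$, while $\partial^\alpha/\partial x^\alpha$ is the classical derivative of functions. *)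

(* Defs.v *)
From HB Require Import structures.
From mathcomp Require Import all_boot all_order all_algebra.
From mathcomp Require Import all_classical all_reals all_analysis.
From mathcomp Require Import complex.

Set Implicit Arguments.
Unset Strict Implicit.
Unset Printing Implicit Defensive.

Import Order.TTheory GRing.Theory Num.Theory.
Import numFieldNormedType.Exports.

Local Open Scope classical_set_scope.
Local Open Scope ring_scope.
Local Open Scope complex_scope.

(** The library norm on ['rV[R]_n] is the sup norm, which
    gives the right topology but not the right distance or spheres. *)

Definition dot {R : realType} {n : nat} (x y : 'rV[R]_n) : R :=
  \sum_i x 0 i * y 0 i.

Definition enorm {R : realType} {n : nat} (x : 'rV[R]_n) : R :=
  Num.sqrt (dot x x).

Definition usphere {R : realType} (d : nat) : set 'rV[R]_d :=
  [set w | enorm w = 1].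

Definition diter {R : realType} {V W : normedModType R} (s : seq V)
    (g : V -> W) : V -> W :=
  foldr (fun v h x => 'D_v h x) g s.

(** Every iterated directional derivative is differentiable; in finite
    dimension this is C^oo. *)
Definition smooth_on {R : realType} {V W : normedModType R} (O : set V)
    (g : V -> W) : Prop :=
  forall (s : seq V) (x : V), O x -> differentiable (diter s g) x.

(** For [A] an embedded submanifold (possibly of a product of coordinate
    spaces): smooth on [A] means locally the restriction of a map that is
    smooth on an open set of the ambient space. *)
Definition smooth_map {R : realType} {V W : normedModType R} (A : set V)
    (g : V -> W) : Prop :=
  forall a, A a -> exists (O : set V) (G : V -> W),
    [/\ open O, O a, smooth_on O G & {in O `&` A, G =1 g}].

Definition diffeomorphism {R : realType} {V W : normedModType R}
    (A : set V) (B : set W) (F : V -> W) (G : W -> V) : Prop :=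
  [/\ (forall a, A a -> B (F a) /\ G (F a) = a),
      (forall b, B b -> A (G b) /\ F (G b) = b),
      smooth_map A F & smooth_map B G].

(** [Sigma] is locally the zero set of a submersion onto [R^d]. *)
Definition submanifold {R : realType} {n : nat} (d : nat)
    (Sigma : set 'rV[R]_n) : Prop :=
  forall xi, Sigma xi -> exists (O : set 'rV[R]_n) (F : 'rV[R]_n -> 'rV[R]_d),
    [/\ open O, O xi, smooth_on O F,
        (forall x, O x -> (Sigma x <-> F x = 0)) &
        (forall x, O x -> forall w, exists v, 'D_v F x = w)].

Definition tangent {R : realType} {n : nat} (Sigma : set 'rV[R]_n)
    (xi v : 'rV[R]_n) : Prop :=
  exists gamma : R^o -> 'rV[R]_n,
    [/\ smooth_on setT gamma, gamma 0 = xi,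
        (\forall t \near (0 : R^o), Sigma (gamma t)) & 'D_1 gamma 0 = v].

Definition normal {R : realType} {n : nat} (Sigma : set 'rV[R]_n)
    (xi w : 'rV[R]_n) : Prop :=
  forall v, tangent Sigma xi v -> dot v w = 0.

(** The fixed data: [Sigma], its tubular neighbourhood with the closest point
    projection, and the cover [U] with normal frames. All maps are total
    functions of which only the values on the relevant sets matter. *)

Record tube_data (R : realType) (n d : nat) := TubeData {
  Sigma : set 'rV[R]_n;
  eps : 'rV[R]_n -> R;
  proj : 'rV[R]_n -> 'rV[R]_n;
  chart : nat -> set 'rV[R]_n;
  frame : nat -> 'I_d -> 'rV[R]_n -> 'rV[R]_n;
  radius : nat -> R }.

Definition tube {R : realType} {n d : nat} (S : tube_data R n d) :
    set 'rV[R]_n :=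
  [set x | exists2 xi, Sigma S xi & enorm (x - xi) < eps S xi].

Definition rho {R : realType} {n d : nat} (S : tube_data R n d)
    (x : 'rV[R]_n) : R :=
  enorm (x - proj S x).

Definition omega {R : realType} {n d : nat} (S : tube_data R n d) (nu : nat)
    (x : 'rV[R]_n) : 'rV[R]_d :=
  \row_k (dot (frame S nu k (proj S x)) (x - proj S x) / rho S x).

Record tubular {R : realType} {n d : nat} (S : tube_data R n d) : Prop := {
  tubular_codim : (0 < d)%N;
  tubular_closed : closed (Sigma S);
  tubular_submanifold : submanifold d (Sigma S);
  tubular_eps_gt0 : forall xi, Sigma S xi -> 0 < eps S xi;
  tubular_eps_cont : {within Sigma S, continuous (eps S)};
  tubular_proj : forall x, tube S x -> Sigma S (proj S x) /\
    forall xi, Sigma S xi -> xi <> proj S x ->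
      enorm (x - proj S x) < enorm (x - xi);
  tubular_proj_smooth : smooth_on (tube S) (proj S);
  tubular_proj_submersion : forall x, tube S x ->
    forall v, tangent (Sigma S) (proj S x) v -> exists w, 'D_w (proj S) x = v;
  tubular_open : forall nu, open (chart S nu);
  tubular_bounded : forall nu, bounded_set (chart S nu);
  tubular_sub : forall nu, chart S nu `<=` tube S;
  tubular_cover : Sigma S `<=` \bigcup_nu chart S nu;
  tubular_meets : forall nu, chart S nu `&` Sigma S !=set0;
  tubular_frame_smooth : forall nu j,
    smooth_map (chart S nu `&` Sigma S) (frame S nu j);
  tubular_frame_orthonormal : forall nu xi, (chart S nu `&` Sigma S) xi ->
    forall j k, dot (frame S nu j xi) (frame S nu k xi) = (j == k)%:R;
  tubular_frame_basis : forall nu xi, (chart S nu `&` Sigma S) xi ->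
    forall w, normal (Sigma S) xi w <->
      exists c : 'I_d -> R, w = \sum_j c j *: frame S nu j xi;
  tubular_radius_gt0 : forall nu, 0 < radius S nu;
  tubular_diffeo : forall nu,
    diffeomorphism
      [set z : 'rV[R]_n * 'rV[R]_d * R^o |
        [/\ (chart S nu `&` Sigma S) z.1.1, usphere z.1.2 &
            0 < (z.2 : R) < radius S nu]]
      (chart S nu `\` Sigma S)
      (fun z => z.1.1 + (z.2 : R) *: \sum_j z.1.2 0 j *: frame S nu j z.1.1)
      (fun x => (proj S x, omega S nu x, rho S x : R^o)) }.

(** Complex valued functions on [R^n]; a function on an open set [O] is
    represented by its extension by 0. *)

Definition cfun (R : realType) (n : nat) : lmodType R[i] := 'rV[R]_n -> R[i]^o.

(** The modulus, as an element of [R]. *)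
Notation cabs := (@ComplexField.Normc.normc _).

Definition csmooth_on {R : realType} {V : normedModType R} (O : set V)
    (g : V -> R[i]) : Prop :=
  smooth_on O (fun x => complex.Re (g x) : R^o) /\
  smooth_on O (fun x => complex.Im (g x) : R^o).

Definition csmooth_map {R : realType} {V : normedModType R} (A : set V)
    (g : V -> R[i]) : Prop :=
  smooth_map A (fun x => complex.Re (g x) : R^o) /\
  smooth_map A (fun x => complex.Im (g x) : R^o).

Definition smooth_fun {R : realType} {n : nat} (O : set 'rV[R]_n)
    (g : cfun R n) : Prop :=
  csmooth_on O g /\ forall x, ~ O x -> g x = 0.

Definition multi_index (n : nat) := {ffun 'I_n -> nat}.

Definition deg {n : nat} (a : multi_index n) : nat := (\sum_i a i)%N.

(** [a_i] copies of the [i]-th coordinate direction, for [i = 0, ..., n-1]. *)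
Definition directions {R : realType} {n : nat} (a : multi_index n) :
    seq 'rV[R]_n :=
  flatten [seq nseq (a i) (delta_mx 0 i) | i <- enum 'I_n].

Definition partial {R : realType} {n : nat} (a : multi_index n)
    (g : cfun R n) : cfun R n :=
  fun x => diter (directions a) (fun y => complex.Re (g y) : R^o) x
        +i* diter (directions a) (fun y => complex.Im (g y) : R^o) x.

(** The derivative of a function on the open set [O], again extended by 0
    (the unrestricted [partial] is meaningless at boundary points of [O]). *)
Definition partial_on {R : realType} {n : nat} (O : set 'rV[R]_n)
    (a : multi_index n) (g : cfun R n) : cfun R n :=
  partial a g \_ O.

Definition compact_in {R : realType} {n : nat} (K Omega : set 'rV[R]_n) :
    Prop :=
  compact K /\ K `<=` interior Omega.

(** [D(Omega)]. *)
Definition test {R : realType} {n : nat} (Omega : set 'rV[R]_n)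
    (phi : cfun R n) : Prop :=
  smooth_fun Omega phi /\
  exists2 K, compact_in K Omega & forall x, ~ K x -> phi x = 0.

Definition coefficients (R : realType) (n d : nat) :=
  int -> 'rV[R]_n -> 'rV[R]_d -> R[i].

Definition smooth_coefficients {R : realType} {n d : nat}
    (S : tube_data R n d) (nu : nat) (a : coefficients R n d) : Prop :=
  forall j, csmooth_map
    [set z : 'rV[R]_n * 'rV[R]_d |
      (Sigma S `&` chart S nu) z.1 /\ usphere z.2]
    (fun z => a j z.1 z.2).

Definition exp_term {R : realType} {n d : nat} (S : tube_data R n d)
    (nu : nat) (a : coefficients R n d) (j : int) : cfun R n :=
  fun x => a j (proj S x) (omega S nu x) * ((rho S x : R) ^ j)%:C.

(** [b ~ c 0 + c 1 + ...] as [rho -> 0], uniformly on [D]. *)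
Definition asymptotic {R : realType} {n d : nat} (S : tube_data R n d)
    (D : set 'rV[R]_n) (b : cfun R n) (c : nat -> cfun R n) : Prop :=
  forall q : int, exists N0, forall N, (N0 <= N)%N ->
  exists C delta : R, 0 < delta /\ forall x, D x -> rho S x < delta ->
    cabs (b x - \sum_(k < N) c k x) <= C * rho S x ^ q.

Definition strong_asymptotic {R : realType} {n d : nat} (S : tube_data R n d)
    (D : set 'rV[R]_n) (b : cfun R n) (c : nat -> cfun R n) : Prop :=
  forall alpha : multi_index n,
    asymptotic S D (partial alpha b) (fun k => partial alpha (c k)).

(** [D_[*,Sigma]^[m;K](Omega)]; [K] is required to be compact in [Omega] where
    this is used. *)
Definition thick_test_in {R : realType} {n d : nat} (S : tube_data R n d)
    (Omega : set 'rV[R]_n) (m : int) (K : set 'rV[R]_n) (phi : cfun R n) :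
    Prop :=
  [/\ smooth_fun (Omega `\` Sigma S) phi,
      (forall x, ~ K x -> phi x = 0) &
      forall nu, exists2 a : coefficients R n d,
        smooth_coefficients S nu a &
        strong_asymptotic S ((Omega `&` chart S nu) `\` Sigma S) phi
          (fun k => exp_term S nu a (m + k%:Z))].

(** [D_[*,Sigma](Omega)]. *)
Definition thick_test {R : realType} {n d : nat} (S : tube_data R n d)
    (Omega : set 'rV[R]_n) (phi : cfun R n) : Prop :=
  exists m K, compact_in K Omega /\ thick_test_in S Omega m K phi.

(** The coefficients [a_(j,alpha)^(phi,nu)] of [partial alpha phi]. They are
    determined by [phi] at the points of [Omega]; since [phi] is extended by 0
    outside [K], so are they, which makes them unique. *)
Definition is_coefficients {R : realType} {n d : nat} (S : tube_data R n d)
    (Omega : set 'rV[R]_n) (m : int) (K : set 'rV[R]_n) (phi : cfun R n)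
    (nu : nat) (alpha : multi_index n) (a : coefficients R n d) : Prop :=
  [/\ smooth_coefficients S nu a,
      (forall j xi w, ~ K xi -> a j xi w = 0) &
      asymptotic S ((Omega `&` chart S nu) `\` Sigma S) (partial alpha phi)
        (fun k => exp_term S nu a (m - (deg alpha)%:Z + k%:Z))].

Definition coefficients_of {R : realType} {n d : nat} (S : tube_data R n d)
    (Omega : set 'rV[R]_n) (m : int) (K : set 'rV[R]_n) (phi : cfun R n)
    (nu : nat) (alpha : multi_index n) : coefficients R n d :=
  if pselect (exists a, is_coefficients S Omega m K phi nu alpha a) is left h
  then projT1 (cid h) else fun _ _ _ => 0.

(** Supremum of a set of nonnegative reals, in [[0, +oo]]. *)
Definition sup0 {R : realType} (A : set R) : \bar R :=
  ereal_sup (0%E |` (EFin @` A)).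

(** The sum below runs over [m - deg alpha <= j <= q - 1]. *)
Definition seminorm {R : realType} {n d : nat} (S : tube_data R n d)
    (Omega : set 'rV[R]_n) (m : int) (K : set 'rV[R]_n) (q : int) (k nu : nat)
    (phi : cfun R n) : \bar R :=
  adde
   (sup0 [set r | exists alpha x,
      [/\ (deg alpha <= k)%N, ((K `&` chart S nu) `\` Sigma S) x &
          r = rho S x ^ (- q) *
            cabs (partial alpha phi x -
              \sum_(l < `|(q - (m - (deg alpha)%:Z))%R|%N)
                exp_term S nu (coefficients_of S Omega m K phi nu alpha)
                  (m - (deg alpha)%:Z + l%:Z) x)]])
   (sup0 [set r | exists alpha x,
      [/\ (deg alpha <= k)%N, (K `\` \bigcup_nu' chart S nu') x &
          r = cabs (partial alpha phi x)]]).

(** Sets that contain a neighbourhood of 0 of the Frechet space [D_[*,Sigma]^[m;K](Omega)]. *)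
Definition thick_nbhs0_in {R : realType} {n d : nat} (S : tube_data R n d)
    (Omega : set 'rV[R]_n) (m : int) (K : set 'rV[R]_n)
    (W : set (cfun R n)) : Prop :=
  exists (l : seq (int * nat * nat)) (delta : R),
    [/\ 0 < delta, (forall p, p \in l -> m < p.1.1) &
        forall phi, thick_test_in S Omega m K phi ->
          (forall p, p \in l ->
            (seminorm S Omega m K p.1.1 p.1.2 p.2 phi < delta%:E)%E) ->
          W phi].

Definition absolutely_convex {R : realType} {n : nat} (W : set (cfun R n)) :
    Prop :=
  forall (a b : R[i]) (u v : cfun R n),
    cabs a + cabs b <= 1 -> W u -> W v -> W (a *: u + b *: v).

(** A base of neighbourhoods of 0 for the inductive limit topology, i.e. the
    finest locally convex one making the inclusions continuous. *)
Definition thick_nbhs0 {R : realType} {n d : nat} (S : tube_data R n d)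
    (Omega : set 'rV[R]_n) (W : set (cfun R n)) : Prop :=
  [/\ W `<=` thick_test S Omega, absolutely_convex W &
      forall m K, compact_in K Omega -> thick_nbhs0_in S Omega m K W].

Lemma linear_extension (F : fieldType) (V : lmodType F) (D : set V)
    (g : V -> F^o) :
  D 0 -> (forall a u v, D u -> D v -> D (a *: u + v)) ->
  (forall a u v, D u -> D v -> g (a *: u + v) = a * g u + g v) ->
  exists2 f : V -> F^o, linear f & {in D, f =1 g}.
Proof.
move=> D0 Dlin glin.
have g0 : g 0 = 0.
  have := glin 1 0 0 D0 D0; rewrite scaler0 add0r mul1r => /eqP.
  by rewrite -subr_eq0 opprD addNKr oppr_eq0 => /eqP.
pose good (G : set (V * F^o)) :=
  [/\ forall u, D u -> G (u, g u),
      forall a p q, G p -> G q -> G (a *: p + q) &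
      forall y, G (0, y) -> y = 0].
have good0 : good [set p | D p.1 /\ p.2 = g p.1].
  split => [u Du //|a [p1 p2] [q1 q2] /= [Dp ->] [Dq ->]|y [_ /= ->] //].
  by split => /=; [exact: Dlin | rewrite glin].
pose T := {G | good G}.
have [||||[G gG] Gmax] :=
  @Zorn T (fun A B => `[< sval A `<=` sval B >]).
- by move=> A; apply/asboolP.
- by move=> A B C /asboolP AB /asboolP BC; apply/asboolP => p /AB/BC.
- move=> [A gA] [B gB] /asboolP AB /asboolP BA.
  by apply: eq_exist; apply/seteqP.
- move=> A Atot.
  pose H := \bigcup_(B in A) sval B `|` [set p | D p.1 /\ p.2 = g p.1].
  have Hsub B : A B -> sval B `<=` H by move=> AB p Bp; left; exists B.
  have Hgood : good H.
    split => [u Du|a p q|y].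
    - by right.
    - have key p' q' (B : T) : sval B p' -> sval B q' -> sval B (a *: p' + q').
        by case: (svalP B) => _ + _ => /[apply]; apply.
      have base (B : T) r : D r.1 /\ r.2 = g r.1 -> sval B r.
        case: r => r1 r2 /= [Dr ->]; by case: (svalP B) => Bg _ _; exact: Bg.
      case=> [[B AB Bp]|Dp] [[C AC Cq]|Dq].
      + have [/asboolP BC|/asboolP CB] := Atot _ _ AB AC.
          by apply: (Hsub C AC); apply: key => //; exact: BC.
        by apply: (Hsub B AB); apply: key => //; exact: CB.
      + by apply: (Hsub B AB); apply: key => //; exact: base.
      + by apply: (Hsub C AC); apply: key => //; exact: base.
      + by right; case: good0 => _ + _; apply.
    - case=> [[B AB By]|[_ /= ->//]].
      by case: (svalP B) => _ _; apply.
  by exists (exist _ H Hgood) => B AB; apply/asboolP; exact: Hsub.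
have [Gg Glin G0] := gG.
have Gscale a p : G p -> G (a *: p).
  move=> Gp; rewrite -[a *: p]addr0; apply: Glin => //.
  by have := Gg 0 D0; rewrite g0.
have Gtot v : exists y, G (v, y).
  apply: contrapT => /forallNP nv.
  pose H := [set p | exists2 q, G q & exists c : F, p = q + c *: (v, 0 : F^o)].
  have Hgood : good H.
    split => [u Du|a p q [p' Gp [c ->]] [q' Gq [e ->]]|y [[q1 q2] Gq [c]]].
    - by exists (u, g u); [exact: Gg | exists 0; rewrite scale0r addr0].
    - exists (a *: p' + q'); first exact: Glin.
      by exists (a * c + e); rewrite scalerDl -scalerA scalerDr addrACA.
    - move=> [] /= e1; rewrite scaler0 addr0 => e2; rewrite e2.
      have [c0|c0] := eqVneq c 0.
        by apply: G0; move: Gq; rewrite e1 c0 scale0r addr0.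
      case: (nv (- c^-1 *: q2)).
      have -> : v = - c^-1 *: q1.
        have /eqP := e1; rewrite eq_sym addr_eq0 => /eqP ->.
        by rewrite scalerN scaleNr opprK scalerA mulVf // scale1r.
      exact: (Gscale _ (q1, q2)).
  have GH : G `<=` H.
    by move=> p Gp; exists p => //; exists 0; rewrite scale0r addr0.
  have /(congr1 sval) /= HG := Gmax (exist _ H Hgood) (asboolT GH).
  apply: (nv 0); rewrite -HG; exists (0, 0 : F^o).
    by have := Gg 0 D0; rewrite g0.
  by exists 1; rewrite scale1r add0r.
have Guniq v y z : G (v, y) -> G (v, z) -> y = z.
  move=> Gy Gz; apply/eqP; rewrite -subr_eq0; apply/eqP/G0.
  have := Glin (-1) _ _ Gz Gy.
  by rewrite scaleN1r /GRing.add /= /add_pair /= addNr addrC.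
pose f v := projT1 (cid (Gtot v)).
have fP v : G (v, f v) by rewrite /f; case: cid.
exists f => [a u v|u /set_mem Du]; last exact: (Guniq _ _ _ (fP u) (Gg u Du)).
by apply: (Guniq _ _ _ (fP _)); exact: (Glin a (u, f u) (v, f v)).
Qed.

(** [D'_[*,Sigma](Omega)]. By [linear_extension], a linear functional on the
    subspace [thick_test S Omega] of [cfun R n] is the restriction of a linear
    functional on [cfun R n]. An element of the dual is represented by such an
    extension, so that it can be composed with operators such as
    [partial_on]; continuity concerns the values on thick test functions only,
    and two representatives are the same element ([thick_eq]) when they agree
    on all thick test functions. *)
Definition thick_dual {R : realType} {n d : nat} (S : tube_data R n d)
    (Omega : set 'rV[R]_n) (f : cfun R n -> R[i]^o) : Prop :=
  linear f /\
  forall e : R, 0 < e -> exists2 W, thick_nbhs0 S Omega W &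
    forall phi, W phi -> cabs (f phi) < e.

Definition thick_eq {R : realType} {n d : nat} (S : tube_data R n d)
    (Omega : set 'rV[R]_n) (f g : cfun R n -> R[i]^o) : Prop :=
  forall phi, thick_test S Omega phi -> f phi = g phi.

Definition dist_eq {R : realType} {n : nat} (Omega : set 'rV[R]_n)
    (f g : cfun R n -> R[i]^o) : Prop :=
  forall phi, test Omega phi -> f phi = g phi.

(** [E_[*,Sigma](Omega)]; the product vanishes off [Omega `\` Sigma] because
    [psi] does. *)
Definition thick_mult {R : realType} {n d : nat} (S : tube_data R n d)
    (Omega : set 'rV[R]_n) (psi : cfun R n) : Prop :=
  smooth_fun (Omega `\` Sigma S) psi /\
  forall phi, test Omega phi -> thick_test S Omega (fun x => phi x * psi x).

Definition thick_deriv {R : realType} {n d : nat} (S : tube_data R n d)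
    (Omega : set 'rV[R]_n) (alpha : multi_index n)
    (f : cfun R n -> R[i]^o) : cfun R n -> R[i]^o :=
  fun phi => (-1) ^+ deg alpha * f (partial_on (Omega `\` Sigma S) alpha phi).

Definition thick_mul {R : realType} {n : nat} (psi : cfun R n)
    (f : cfun R n -> R[i]^o) : cfun R n -> R[i]^o :=
  fun phi => f (fun x => psi x * phi x).

(** [Pi]: the inclusion [D(Omega) -> D_[*,Sigma](Omega)] is the restriction of
    functions to [Omega `\` Sigma]. *)
Definition Pi {R : realType} {n d : nat} (S : tube_data R n d)
    (Omega : set 'rV[R]_n) (f : cfun R n -> R[i]^o) : cfun R n -> R[i]^o :=
  fun phi => f (phi \_ (Omega `\` Sigma S)).

Definition dist_deriv {R : realType} {n : nat} (alpha : multi_index n)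
    (u : cfun R n -> R[i]^o) : cfun R n -> R[i]^o :=
  fun phi => (-1) ^+ deg alpha * u (partial alpha phi).

(** [below alpha] ranges over the multi-indices [beta <= alpha]. *)
Definition below {n : nat} (alpha : multi_index n) :=
  {dffun forall i : 'I_n, 'I_(alpha i).+1}.

Definition below_index {n : nat} (alpha : multi_index n) (b : below alpha) :
    multi_index n :=
  [ffun i => b i : nat].

Definition below_compl {n : nat} (alpha : multi_index n) (b : below alpha) :
    multi_index n :=
  [ffun i => (alpha i - b i)%N].

Definition multi_binomial {n : nat} (alpha beta : multi_index n) : nat :=
  (\prod_i 'C(alpha i, beta i))%N.

(* Main.v *)
Require Import Defs.
From HB Require Import structures.
From mathcomp Require Import all_boot all_order all_algebra.
From mathcomp Require Import all_classical all_reals all_analysis.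
From mathcomp Require Import complex ring.
Import Order.TTheory GRing.Theory Num.Theory.
Import numFieldNormedType.Exports.
Local Open Scope classical_set_scope.
Local Open Scope ring_scope.
Set Implicit Arguments.
Unset Strict Implicit.
Unset Printing Implicit Defensive.

(** Every operation on thick distributions is a transpose, so both claims are
    identities between test functions to which [f] is then applied. Write [O]
    for the open set [Omega `\` Sigma].

    The first claim says that restricting a function to [O] and differentiating
    it on [O] commute ([partial_on_restrict]), because derivatives are local.

    The second claim, tested on [phi], is [f] applied to the dual Leibniz rule
    [psi * d^a phi = sum_(b <= a) (-1)^|b| 'C(a, b) d^(a-b) (d^b psi * phi)]
    ([leibniz_dual_partial_on]); the sign [(-1)^|b|] is what is left of the
    signs [(-1)^|a|] and [(-1)^|a-b|] in the definition of the thick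
    derivatives. This rule holds for any commuting family of derivations
    ([leibniz_dual]). It is proved by induction on [|a|]: raising the [i]-th
    exponent of [a] by one splits each binomial coefficient by Pascal's rule
    ([sum_below_incr]), and the two halves combine into
    [d_i (d^b psi * phi) - d_i d^b psi * phi = d^b psi * d_i phi], which is the
    induction hypothesis for [d_i phi].

    What analysis has to supply is that the partial derivatives are commuting
    derivations of the algebra of smooth functions on [O]: stability of
    smoothness under products, and the symmetry of second derivatives
    ([derive_comm]), proved by applying the mean value theorem twice to a second
    difference. *)

(** * Symmetry of second directional derivatives *)

Lemma derive_line {R : realType} {V : normedModType R} (g : V -> R^o)
    (p v : V) (t : R) :
  differentiable g (p + t *: v) ->
  is_derive t (1 : R) (fun s : R => g (p + s *: v) : R) ('D_v g (p + t *: v)).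
Proof.
move=> dg0; have dg : derivable g (p + t *: v) v by exact: diff_derivable.
have E : (fun h : R => h^-1 *: (((fun s : R => g (p + s *: v)) \o shift t)
      (h *: (1 : R)) - g (p + t *: v))) =
    (fun h : R => h^-1 *: ((g \o shift (p + t *: v)) (h *: v) -
      g (p + t *: v))).
  apply/funext => h /=; congr (_ *: (g _ - _)).
  by rewrite [_ *: 1]mulr1 scalerDl addrCA.
by split; rewrite ?/derivable ?/derive E.
Qed.

Lemma derive_mvt {R : realType} {V : normedModType R} (g : V -> R^o)
    (p v : V) (h : R) : 0 < h ->
  (forall t, 0 <= t <= h -> differentiable g (p + t *: v)) ->
  exists2 t, 0 < t < h & g (p + h *: v) - g p = h * 'D_v g (p + t *: v).
Proof.
move=> h0 dg.
have [t||t th] := @MVT R (fun s => g (p + s *: v))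
    (fun s => 'D_v g (p + s *: v)) 0 h h0.
- by rewrite in_itv /= => /andP[t0 th]; apply/derive_line/dg; rewrite !ltW.
- apply: derivable_within_continuous => t; rewrite in_itv /= => th.
  exact: (@ex_derive _ _ _ _ _ _ _ (derive_line (dg t th))).
- rewrite scale0r addr0 subr0 mulrC => gE; exists t => //.
Qed.

(** The second difference does not distinguish [v] from [w], while its value
    involves the derivatives in the order [v], then [w]; comparing it with the
    same formula for the other order gives [derive_comm]. *)
Lemma second_difference {R : realType} {V : normedModType R} (O : set V)
    (g : V -> R^o) (x v w : V) (h : R) : 0 < h ->
  (forall a b, 0 <= a <= h -> 0 <= b <= h -> O (x + a *: v + b *: w)) ->
  (forall y, O y -> differentiable g y /\ differentiable ('D_v g) y) ->
  exists a b, [/\ 0 < a < h, 0 < b < h &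
    g (x + h *: v + h *: w) - g (x + h *: v) - g (x + h *: w) + g x =
      h * (h * 'D_w ('D_v g) (x + a *: v + b *: w))].
Proof.
move=> h0 Oab dg.
have hh : 0 <= h <= h by rewrite lexx ltW.
have zh : 0 <= (0 : R) <= h by rewrite lexx ltW.
(* The mean value theorem along [v] for the difference [k] in direction [w],
   then along [w] for ['D_v g]. *)
pose k : V -> R^o := (g \o shift (h *: w)) - g.
have dO a b : 0 <= a <= h -> 0 <= b <= h ->
    differentiable g (x + a *: v + b *: w) /\
    differentiable ('D_v g) (x + a *: v + b *: w).
  by move=> ah bh; apply: dg; exact: Oab.
have dO0 a : 0 <= a <= h -> differentiable g (x + a *: v).
  by move=> ah; have [] := dO a 0 ah zh; rewrite scale0r addr0.
have dOs a : 0 <= a <= h ->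
    differentiable (g \o shift (h *: w)) (x + a *: v).
  move=> ah; have [dh _] := dO a h ah hh.
  have ds : differentiable (shift (h *: w)) (x + a *: v).
    exact: differentiableD.
  exact: (differentiable_comp ds dh).
have [a ah kE] := @derive_mvt R V k x v h h0 (fun a ah =>
  differentiableB (dOs a ah) (dO0 a ah)).
have ah' : 0 <= a <= h by case/andP: ah => ? ?; rewrite !ltW.
have [b bh dE] := @derive_mvt R V ('D_v g) (x + a *: v) w h h0 (fun b bh =>
  (dO a b ah' bh).2).
exists a, b; split=> //.
transitivity (k (x + h *: v) - k x).
  by rewrite /k /= !fctE /= opprB [_ + h *: w]addrC [g x - _]addrC !addrA.
rewrite kE -dE; congr (_ * _).
rewrite /k deriveB; last 2 first.
- exact/diff_derivable/dOs.
- exact/diff_derivable/dO0.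
congr (_ - _); rewrite /derive.
by under eq_fun do rewrite /= -addrA.
Qed.

Lemma derive_comm {R : realType} {V : normedModType R} (O : set V)
    (g : V -> R^o) (x v w : V) : open O -> O x ->
  (forall y, O y -> [/\ differentiable g y, differentiable ('D_v g) y &
    differentiable ('D_w g) y]) ->
  {for x, continuous ('D_w ('D_v g))} -> {for x, continuous ('D_v ('D_w g))} ->
  'D_w ('D_v g) x = 'D_v ('D_w g) x.
Proof.
move=> oO Ox dg cwv cvw; apply/eqP; rewrite eq_sym -subr_eq0 -normr_le0.
apply/ler_addgt0Pr => e e0; rewrite add0r.
have e2 : 0 < e / 2 by rewrite divr_gt0.
have nO : nbhs x O by exact: open_nbhs_nbhs.
have nwv : \forall y \near x, `|'D_w ('D_v g) x - 'D_w ('D_v g) y| < e / 2.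
  by move/cvgrPdist_lt : cwv; apply.
have nvw : \forall y \near x, `|'D_v ('D_w g) x - 'D_v ('D_w g) y| < e / 2.
  by move/cvgrPdist_lt : cvw; apply.
pose N := [set y | [/\ O y, `|'D_w ('D_v g) x - 'D_w ('D_v g) y| < e / 2 &
  `|'D_v ('D_w g) x - 'D_v ('D_w g) y| < e / 2]].
have : nbhs x N by apply: filterS (filterI nO (filterI nwv nvw)) => y [? []].
move=> /nbhs_ballP[r /= r0 rB].
have m0 : 0 < `|v| + `|w| + 1 by rewrite ltr_wpDl // addr_ge0.
(* The parallelogram spanned by [h *: v] and [h *: w] at [x] lies in the ball
   of radius [r]; the added 1 covers the case [v = w = 0]. *)
pose h := r / (`|v| + `|w| + 1).
have h0 : 0 < h by rewrite divr_gt0.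
have inB a b : 0 <= a <= h -> 0 <= b <= h -> ball x r (x + a *: v + b *: w).
  case/andP=> a0 ah /andP[b0 bh]; rewrite -ball_normE /ball_ /=.
  rewrite -addrA opprD addNKr normrN.
  rewrite (le_lt_trans (ler_normD _ _)) // !normrZ !ger0_norm //.
  rewrite (@le_lt_trans _ _ (h * (`|v| + `|w|))) //.
    by rewrite mulrDr lerD // ler_wpM2r.
  by rewrite -[ltRHS](divfK (lt0r_neq0 m0)) ltr_pM2l // ltrDl.
have inO a b : 0 <= a <= h -> 0 <= b <= h -> O (x + a *: v + b *: w).
  by move=> ah bh; have [] := rB _ (inB a b ah bh).
have inO' b a : 0 <= b <= h -> 0 <= a <= h -> O (x + b *: w + a *: v).
  by move=> bh ah; rewrite addrAC; exact: inO.
have [a [b [ah bh E1]]] := @second_difference R V O g x v w h h0 inO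
  (fun y Oy => let: And3 p q _ := dg y Oy in conj p q).
have [b' [a' [bh' ah' E2]]] := @second_difference R V O g x w v h h0 inO'
  (fun y Oy => let: And3 p _ q := dg y Oy in conj p q).
have := E2; rewrite [x + h *: w + _]addrAC.
rewrite [X in X + g x]addrAC E1.
move=> /(mulfI (lt0r_neq0 h0))/(mulfI (lt0r_neq0 h0)).
rewrite [x + _ *: w + _]addrAC.
have lw (t : R) : 0 < t < h -> 0 <= t <= h by case/andP=> ? ?; rewrite !ltW.
have [_ B1 _] := rB _ (inB _ _ (lw _ ah) (lw _ bh)).
have [_ _ B2] := rB _ (inB _ _ (lw _ ah') (lw _ bh')).
move=> E; rewrite -E in B2.
rewrite [e]splitr.
apply: (le_trans (ler_distD ('D_w ('D_v g) (x + a *: v + b *: w)) _ _)).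
by apply/lerD; [exact/ltW/B2 | rewrite distrC; exact/ltW/B1].
Qed.

(** * Smooth real functions on an open set *)

(** The difference of [f] and [g] vanishes near [x], so its differential at [x]
    is 0. *)
Lemma near_eq_differentiable {R : numFieldType} {V W : normedModType R}
    (f g : V -> W) (x : V) :
  (\near x, f x = g x) -> differentiable f x -> differentiable g x.
Proof.
move=> fg df.
suff dk : differentiable (g - f) x.
  by have -> : g = f + (g - f); [rewrite addrC subrK | exact: differentiableD].
have kE : \forall h \near (0 : V), ((g - f) \o shift x) h = 0.
  have [r /= r0 rE] := (nbhs_ballP _ _).1 fg.
  apply/nbhs_ballP; exists r => // h; rewrite -ball_normE /= sub0r normrN => hr.
  apply/eqP; rewrite fctE subr_eq0 eq_sym; apply/eqP/rE.
  by rewrite -ball_normE /= opprD addrCA subrr addr0 normrN.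
have k0 : (g - f) x = 0.
  have fgx : f x = g x := nbhs_singleton fg.
  by change (g x - f x = 0); rewrite fgx subrr.
have lE : (g - f) \o shift x =
    cst ((g - f) x) + (\0 : {linear V -> W}) +o_ (0 : V) id.
  apply/eqaddoP => e e0; near=> h.
  have kh : ((g - f) \o shift x) h = 0 by exact: (near kE h).
  change (`|((g - f) \o shift x) h - ((g - f) x + 0)| <= e * `|h|).
  by rewrite kh k0 addr0 subr0 normr0 mulr_ge0 // ltW.
have c0 : continuous (\0 : {linear V -> W}) by move=> y; exact: cvg_cst.
by apply/diff_locallyP; rewrite (diff_unique c0 lE).
Unshelve. all: by end_near. Qed.

Lemma diter_rcons {R : realType} {V W : normedModType R} (s : seq V) (v : V)
    (g : V -> W) :
  diter (rcons s v) g = diter s (fun x => 'D_v g x).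
Proof. by rewrite /diter foldr_rcons. Qed.

Section SmoothOn.
Context {R : realType} {V : normedModType R} (O : set V).
Hypothesis oO : open O.
Implicit Types (f g : V -> R^o) (s : seq V) (v w x : V).

Let near_open f g x : (forall y, O y -> f y = g y) -> O x ->
  \forall y \near x, f y = g y.
Proof.
move=> fg Ox; have nO : nbhs x O by exact: open_nbhs_nbhs.
exact: filterS nO.
Qed.

Lemma eq_diter f g s : (forall x, O x -> f x = g x) ->
  forall x, O x -> diter s f x = diter s g x.
Proof.
move=> fg; elim: s => //= v s IH x Ox.
by apply: near_eq_derive; exact: near_open.
Qed.

Lemma eq_smooth_on f g : (forall x, O x -> f x = g x) ->
  smooth_on O f -> smooth_on O g.
Proof.
move=> fg sf s x Ox; apply: near_eq_differentiable (sf s x Ox).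
by apply: near_open => //; exact: eq_diter.
Qed.

Lemma smooth_on_derive f v : smooth_on O f ->
  smooth_on O (fun x => 'D_v f x : R^o).
Proof. by move=> sf s x Ox; rewrite -diter_rcons; exact: sf. Qed.

(** Only derivatives of lower order need to be differentiable: [smooth_onM] uses
    this when smoothness is known only up to a given order. *)
Lemma diter_lin (a : R) f g s :
  (forall t x, (size t < size s)%N -> O x -> differentiable (diter t f) x) ->
  (forall t x, (size t < size s)%N -> O x -> differentiable (diter t g) x) ->
  forall x, O x ->
    diter s (a *: f + g : V -> R^o) x = a *: diter s f x + diter s g x.
Proof.
elim: s => //= v s IH sf sg x Ox.
have df := diff_derivable (sf s x (leqnn _) Ox).
have dg := diff_derivable (sg s x (leqnn _) Ox).
rewrite (near_eq_derive (g := a *: diter s f + diter s g)).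
  by rewrite deriveD ?deriveZ //; exact: derivableZ.
apply: near_open => // y Oy; apply: IH => // t z ts Oz.
- by apply: sf => //; exact: ltnW.
- by apply: sg => //; exact: ltnW.
Qed.

Lemma smooth_on_lin (a : R) f g : smooth_on O f -> smooth_on O g ->
  smooth_on O (a *: f + g : V -> R^o).
Proof.
move=> sf sg s x Ox.
apply: (near_eq_differentiable (f := a *: diter s f + diter s g)).
  apply: near_open => // y Oy.
  by rewrite diter_lin // => t z _; [exact: sf | exact: sg].
by apply: differentiableD; [apply: differentiableZ; exact: sf | exact: sg].
Qed.

(** By induction on the order of differentiation: the innermost derivative of
    the product is a sum of two products of smooth functions, of which one order
    less has to be checked. *)
Lemma smooth_onM f g : smooth_on O f -> smooth_on O g ->
  smooth_on O (fun x => f x * g x : R^o).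
Proof.
move=> sf sg s; move: (leqnn (size s)); move: {2}(size s) => k.
elim: k s f g sf sg => [|k IH] s f g sf sg.
  rewrite leqn0 size_eq0 => /eqP -> x Ox.
  by apply: (@differentiableM R V f g); [exact: (sf [::]) | exact: (sg [::])].
case/lastP: s => [_|s v]; first exact: (IH [::]).
rewrite size_rcons ltnS diter_rcons => sk x Ox.
have sf' := smooth_on_derive v sf; have sg' := smooth_on_derive v sg.
pose h1 y : R^o := f y * 'D_v g y; pose h2 y : R^o := g y * 'D_v f y.
have hE y : O y -> 'D_v (fun x => f x * g x : R^o) y = (1 *: h1 + h2) y.
  move=> Oy; rewrite scale1r.
  by apply: (@deriveM R V f g); apply: diff_derivable;
    [exact: (sf [::]) | exact: (sg [::])].
have d1 t y : (size t <= k)%N -> O y -> differentiable (diter t h1) y.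
  by move=> tk Oy; exact: (IH t f _ sf sg').
have d2 t y : (size t <= k)%N -> O y -> differentiable (diter t h2) y.
  by move=> tk Oy; exact: (IH t g _ sg sf').
apply: (near_eq_differentiable (f := 1 *: diter s h1 + diter s h2)).
  apply: near_open => // y Oy.
  rewrite (eq_diter s hE Oy) diter_lin // => t z ts.
  - by apply: d1; exact: leq_trans (ltnW ts) sk.
  - by apply: d2; exact: leq_trans (ltnW ts) sk.
by apply: differentiableD; [apply: differentiableZ; exact: d1 | exact: d2].
Qed.

Lemma smooth_on_derive_comm f v w x : smooth_on O f -> O x ->
  'D_w ('D_v f) x = 'D_v ('D_w f) x.
Proof.
move=> sf Ox; apply: (derive_comm oO Ox).
- move=> y Oy; split; first exact: (sf [::]).
  + exact: (sf [:: v]).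
  + exact: (sf [:: w]).
- exact: differentiable_continuous (sf [:: w; v] x Ox).
- exact: differentiable_continuous (sf [:: v; w] x Ox).
Qed.

End SmoothOn.

(** * Complex smooth functions and their derivatives *)

Section ComplexParts.
Context {R : rcfType}.
Implicit Types a b : R[i].

Lemma Re_mul a b : complex.Re (a * b) =
  complex.Re a * complex.Re b - complex.Im a * complex.Im b.
Proof. by case: a b => [? ?] []. Qed.

Lemma Im_mul a b : complex.Im (a * b) =
  complex.Re a * complex.Im b + complex.Im a * complex.Re b.
Proof. by case: a b => [? ?] []. Qed.

Lemma Re_add a b : complex.Re (a + b) = complex.Re a + complex.Re b.
Proof. by case: a b => [? ?] []. Qed.

Lemma Im_add a b : complex.Im (a + b) = complex.Im a + complex.Im b.
Proof. by case: a b => [? ?] []. Qed.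

End ComplexParts.

Section SmoothFun.
Context {R : realType} {n : nat} (O : set 'rV[R]_n).
Hypothesis oO : open O.
Implicit Types (g h : cfun R n) (v w x : 'rV[R]_n).

(** Cutting off outside [O] makes [cderiv v] an operator on the functions that
    are smooth on [O] and 0 elsewhere, on which the rules below hold as
    equalities of functions. *)
Definition cderiv v g : cfun R n :=
  ((fun x => 'D_v (fun y => complex.Re (g y) : R^o) x
          +i* 'D_v (fun y => complex.Im (g y) : R^o) x)%C : cfun R n) \_ O.

Lemma cderivE v g x : O x ->
  cderiv v g x = ('D_v (fun y => complex.Re (g y) : R^o) x
         +i* 'D_v (fun y => complex.Im (g y) : R^o) x)%C.
Proof. by move=> Ox; rewrite /cderiv patchT // inE. Qed.

Lemma cderiv_out v g x : ~ O x -> cderiv v g x = 0.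
Proof. by move=> Ox; rewrite /cderiv patchC // inE. Qed.

Lemma smooth_fun_cderiv v g : smooth_fun O g -> smooth_fun O (cderiv v g).
Proof.
move=> [[sr si] _]; split; last exact: cderiv_out.
split.
- apply: eq_smooth_on (smooth_on_derive v sr) => // x Ox.
  by rewrite cderivE.
- apply: eq_smooth_on (smooth_on_derive v si) => // x Ox.
  by rewrite cderivE.
Qed.

Lemma smooth_funM g h : smooth_fun O g -> smooth_fun O h ->
  smooth_fun O (fun x => g x * h x).
Proof.
move=> [[gr gi] g0] [[hr hi] _]; split; last first.
  by move=> x Ox; rewrite g0 // mul0r.
split.
- apply: eq_smooth_on (smooth_on_lin oO (-1) (smooth_onM oO gi hi)
    (smooth_onM oO gr hr)) => // x _ /=.
  change (-1 * (complex.Im (g x) * complex.Im (h x)) +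
    complex.Re (g x) * complex.Re (h x) = complex.Re (g x * h x)).
  by rewrite Re_mul mulN1r addrC.
- apply: eq_smooth_on (smooth_on_lin oO 1 (smooth_onM oO gr hi)
    (smooth_onM oO gi hr)) => // x _ /=.
  by rewrite scale1r [RHS]Im_mul.
Qed.

Lemma smooth_fun_derivable g v x : smooth_fun O g -> O x ->
  derivable (fun y => complex.Re (g y) : R^o) x v /\
  derivable (fun y => complex.Im (g y) : R^o) x v.
Proof.
move=> [[gr gi] _] Ox.
by split; apply: diff_derivable; [exact: (gr [::]) | exact: (gi [::])].
Qed.

Lemma cderivD v g h : smooth_fun O g -> smooth_fun O h ->
  cderiv v (g + h) = cderiv v g + cderiv v h.
Proof.
move=> sg sh; apply/funext => x.
change (cderiv v (g + h) x = cderiv v g x + cderiv v h x).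
have [Ox|Ox] := pselect (O x); last by rewrite !cderiv_out // addr0.
have [gr gi] := smooth_fun_derivable v sg Ox.
have [hr hi] := smooth_fun_derivable v sh Ox.
rewrite !cderivE // -[RHS]/(_ +i* _)%C /= -!deriveD //.
by congr (_ +i* _)%C; congr (derive _ x v); apply/funext => y;
  [exact: Re_add | exact: Im_add].
Qed.

Lemma cderivM v g h : smooth_fun O g -> smooth_fun O h ->
  cderiv v (fun x => g x * h x) =
    (fun x => cderiv v g x * h x) + (fun x => g x * cderiv v h x) :> cfun R n.
Proof.
move=> sg sh; apply/funext => x.
change (cderiv v (fun x => g x * h x) x =
  cderiv v g x * h x + g x * cderiv v h x).
have [Ox|Ox] := pselect (O x); last first.
  by rewrite !cderiv_out // mul0r mulr0 addr0.
have [gr gi] := smooth_fun_derivable v sg Ox.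
have [hr hi] := smooth_fun_derivable v sh Ox.
rewrite !cderivE //.
set gR := (fun y => complex.Re (g y)) in gr *.
set gI := (fun y => complex.Im (g y)) in gi *.
set hR := (fun y => complex.Re (h y)) in hr *.
set hI := (fun y => complex.Im (h y)) in hi *.
have -> : (fun y => complex.Re (g y * h y) : R^o) = gR * hR - gI * hI.
  by apply/funext => y; exact: Re_mul.
have -> : (fun y => complex.Im (g y * h y) : R^o) = gR * hI + gI * hR.
  by apply/funext => y; exact: Im_mul.
have dM (p q : 'rV[R]_n -> R^o) : derivable p x v -> derivable q x v ->
    derivable (p * q) x v /\
    'D_v (p * q) x = p x * 'D_v q x + q x * 'D_v p x.
  by move=> dp dq; split; [exact: derivableM | exact: deriveM].
have [rr rrE] := dM _ _ gr hr; have [ii iiE] := dM _ _ gi hi.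
have [ri riE] := dM _ _ gr hi; have [ir irE] := dM _ _ gi hr.
rewrite (deriveB rr ii) (deriveD ri ir) rrE iiE riE irE.
apply/eqP; rewrite eq_complex !(Re_add, Im_add, Re_mul, Im_mul) /=.
rewrite -/(gR x) -/(gI x) -/(hR x) -/(hI x).
by apply/andP; split; apply/eqP; rewrite /gR /gI /hR /hI; ring.
Qed.

Lemma cderivC v w g : smooth_fun O g ->
  cderiv v (cderiv w g) = cderiv w (cderiv v g).
Proof.
move=> sg; apply/funext => x.
have [Ox|Ox] := pselect (O x); last by rewrite !cderiv_out.
have [[gr gi] _] := sg.
have nO : nbhs x O by exact: open_nbhs_nbhs.
have dR u t : 'D_t (fun y => complex.Re (cderiv u g y) : R^o) x =
    'D_t (fun y => 'D_u (fun z => complex.Re (g z) : R^o) y : R^o) x.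
  by apply: near_eq_derive; apply: filterS nO => y Oy; rewrite cderivE.
have dI u t : 'D_t (fun y => complex.Im (cderiv u g y) : R^o) x =
    'D_t (fun y => 'D_u (fun z => complex.Im (g z) : R^o) y : R^o) x.
  by apply: near_eq_derive; apply: filterS nO => y Oy; rewrite cderivE.
rewrite (cderivE v _ Ox) (cderivE w _ Ox) !dR !dI.
by rewrite (smooth_on_derive_comm oO w v gr Ox)
  (smooth_on_derive_comm oO w v gi Ox).
Qed.

End SmoothFun.

(** * Sums over multi-indices and Pascal's rule *)

Section MultiIndices.
Context {n : nat}.
Implicit Types (a b c : multi_index n) (i j : 'I_n).

Definition incr a i : multi_index n := [ffun j => (a j + (j == i))%N].
Definition decr a i : multi_index n := [ffun j => (a j - (j == i))%N].
Definition subm a b : multi_index n := [ffun j => (a j - b j)%N].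

Definition exponents a : seq 'I_n :=
  flatten [seq nseq (a i) i | i <- enum 'I_n].

Lemma count_exponents a i : count_mem i (exponents a) = a i.
Proof.
rewrite /exponents count_flatten -map_comp sumnE big_map big_enum /=.
rewrite (bigD1 i) //= count_nseq /= eqxx mul1n big1 ?addn0 // => j ji.
by rewrite count_nseq /= (negbTE ji).
Qed.

Lemma exponents_incr a i : perm_eq (exponents (incr a i)) (i :: exponents a).
Proof.
apply/allP => j _ /=; rewrite !count_exponents ffunE.
by rewrite [i == j]eq_sym [in eqbRHS]addnC.
Qed.

Lemma decrK a i : (0 < a i)%N -> incr (decr a i) i = a.
Proof.
move=> ai; apply/ffunP => j; rewrite !ffunE.
by have [->|_] := eqVneq j i; rewrite ?subn0 ?addn0 // subnK.
Qed.

Lemma deg_incr a i : deg (incr a i) = (deg a).+1.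
Proof.
rewrite /deg; under eq_bigr do rewrite ffunE.
rewrite big_split /= -addn1; congr (_ + _)%N.
by rewrite (bigD1 i) //= eqxx big1 // => j /negbTE ->.
Qed.

Lemma multi_binomial_incr a b i : multi_binomial (incr a i) b =
  (multi_binomial a b + (0 < b i) * multi_binomial a (decr b i))%N.
Proof.
rewrite /multi_binomial !(bigD1 i (P := xpredT)) //= !ffunE eqxx addn1.
rewrite (eq_bigr (fun j => 'C(a j, b j))); last first.
  by move=> j /negbTE ji; rewrite ffunE ji addn0.
rewrite [X in (_ + _ * (_ * X))%N](eq_bigr (fun j => 'C(a j, b j))); last first.
  by move=> j /negbTE ji; rewrite ffunE ji subn0.
case: (b i) => [|k]; first by rewrite !bin0 mul0n addn0.
by rewrite binS subn1 /= mul1n mulnDl.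
Qed.

Lemma multi_binomial_small a b i : (a i < b i)%N -> multi_binomial a b = 0%N.
Proof. by move=> ab; rewrite /multi_binomial (bigD1 i) //= bin_small. Qed.

Definition of_box {N} (b : {ffun 'I_n -> 'I_N}) : multi_index n :=
  [ffun i => b i : nat].

(** The index type [below a] depends on [a]. Since binomial coefficients vanish
    outside [below a], the sum can be taken over any larger box, which can be
    shared by two different [a]. *)
Lemma sum_below_box {V : nmodType} (F : multi_index n -> V) a N :
  (forall i, (a i <= N)%N) ->
  \sum_(b : below a) F (below_index b) *+ multi_binomial a (below_index b) =
  \sum_(b : {ffun 'I_n -> 'I_N.+1}) F (of_box b) *+ multi_binomial a (of_box b).
Proof.
move=> aN.
rewrite [RHS](bigID (fun b : {ffun 'I_n -> 'I_N.+1} =>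
  [forall i, (b i <= a i)%N])) /=.
rewrite [X in _ = _ + X]big1 ?addr0; last first.
  move=> b /forallPn[k]; rewrite -ltnNge => ab.
  by rewrite (@multi_binomial_small _ _ k) ?mulr0n // ffunE.
rewrite (reindex_onto (fun b : below a =>
    [ffun i => inord (b i)] : {ffun 'I_n -> 'I_N.+1})
  (fun b : {ffun 'I_n -> 'I_N.+1} =>
    (finfun (fun i => inord (b i)) : below a))) /=; last first.
  move=> b /forallP ba; apply/ffunP => i; rewrite !ffunE.
  by rewrite [X in inord X]inordK ?inord_val // ltnS.
have bN : forall (b : below a) i, (b i < N.+1)%N.
  by move=> b i; rewrite ltnS; apply: leq_trans (aN i); rewrite -ltnS.
apply: esym; apply: eq_big => [b|b _].
  apply/andP; split.
    by apply/forallP => i; rewrite ffunE inordK // -ltnS.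
  by apply/eqP/ffunP => i; rewrite !ffunE inordK // inord_val.
have bE : of_box [ffun i => inord (b i) : 'I_N.+1] = below_index b.
  by apply/ffunP => i; rewrite !ffunE inordK.
by rewrite bE.
Qed.

(** Pascal's rule in the [i]-th variable, followed by the shift of [b] by one in
    that variable in the second half of the sum. *)
Lemma sum_below_incr {V : nmodType} (F : multi_index n -> V) a i :
  \sum_(b : below (incr a i))
     F (below_index b) *+ multi_binomial (incr a i) (below_index b) =
  \sum_(b : below a)
     (F (below_index b) + F (incr (below_index b) i)) *+
       multi_binomial a (below_index b).
Proof.
pose N := (deg a).+1.
have aN j : (a j <= deg a)%N by rewrite /deg (bigD1 j) //= leq_addr.
have a'N j : (incr a i j <= N)%N.
  by rewrite ffunE /N -addn1 leq_add // leq_b1.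
rewrite (sum_below_box F a'N).
rewrite (sum_below_box (fun b => F b + F (incr b i)) (N := N)); last first.
  by move=> j; exact: leqW.
under eq_bigr do rewrite multi_binomial_incr mulrnDr.
under [RHS]eq_bigr do rewrite mulrnDl.
rewrite !big_split /=; congr (_ + _).
rewrite (bigID (fun b : {ffun 'I_n -> 'I_N.+1} => (0 < b i)%N)) /=.
rewrite [X in _ + X]big1 ?addr0; last first.
  by move=> b; rewrite !ffunE => /negbTE ->; rewrite mul0n mulr0n.
rewrite [RHS](bigID (fun b : {ffun 'I_n -> 'I_N.+1} => (b i < N)%N)) /=.
rewrite [X in _ = _ + X]big1 ?addr0; last first.
  move=> b; rewrite -leqNgt => bN.
  rewrite (@multi_binomial_small _ _ i) ?mulr0n // ffunE.
  by apply: leq_trans bN; rewrite ltnS.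
(* If [b i = N], then [inord N.+1] is 0, and the condition [0 < b i] on the
   shifted index fails, so such [b] are excluded on the left as well. *)
rewrite (reindex_onto
  (fun b : {ffun 'I_n -> 'I_N.+1} => [ffun j => inord (b j + (j == i))])
  (fun b : {ffun 'I_n -> 'I_N.+1} =>
    [ffun j => inord (b j - (j == i))])) /=; last first.
  move=> b bi; apply/ffunP => j; rewrite !ffunE; apply: val_inj => /=.
  have bj : (b j - (j == i) < N.+1)%N by apply: leq_ltn_trans (leq_subr _ _) _.
  rewrite (inordK bj) subnK ?inord_val //.
  by have [->|] := eqVneq j i.
have shiftE : forall b : {ffun 'I_n -> 'I_N.+1}, (b i < N)%N ->
    of_box [ffun j => inord (b j + (j == i)) : 'I_N.+1] = incr (of_box b) i.
  move=> b bi; apply/ffunP => j; rewrite !ffunE inordK //.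
  by have [->|_] := eqVneq j i; rewrite ?addn1 ?addn0.
apply: eq_big => [b|b].
  rewrite ffunE eqxx addn1.
  have [bN|bN] := ltnP (b i) N.
    rewrite inordK //=; apply/eqP/ffunP => j; rewrite !ffunE.
    rewrite inordK ?addnK ?inord_val //.
    by have [->|_] := eqVneq j i; rewrite ?addn1 ?addn0.
  rewrite /inord /insubd insubF //.
  by apply/negbTE; rewrite -leqNgt.
case/andP; rewrite ffunE eqxx addn1 => b0 _.
have bN : (b i < N)%N.
  rewrite ltnNge; apply/negP => bN; move: b0.
  by rewrite /inord /insubd insubF //; apply/negbTE; rewrite -leqNgt.
rewrite shiftE // ffunE eqxx addn1 /= mul1n; congr (_ *+ multi_binomial _ _).
by apply/ffunP => j; rewrite !ffunE addnK.
Qed.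

End MultiIndices.

(** * The dual Leibniz rule for commuting derivations *)

(** The rules are assumed only on [P], because directional derivatives are
    additive only on differentiable functions. *)
Section CommutingDerivations.
Context {n : nat} {K : nzRingType} {V : lmodType K}.
Variables (P : V -> Prop) (mul : V -> V -> V) (D : 'I_n -> V -> V).
Hypothesis P_D : forall i u, P u -> P (D i u).
Hypothesis P_mul : forall u v, P u -> P v -> P (mul u v).
Hypothesis D_add : forall i u v, P u -> P v -> D i (u + v) = D i u + D i v.
Hypothesis D_mul : forall i u v, P u -> P v ->
  D i (mul u v) = mul (D i u) v + mul u (D i v).
Hypothesis D_comm : forall i j u, P u -> D i (D j u) = D j (D i u).
Implicit Types (a : multi_index n) (s t : seq 'I_n) (i j : 'I_n).

Definition mderiv a u : V := foldr D u (exponents a).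

Lemma foldr_deriv_P s u : P u -> P (foldr D u s).
Proof. by move=> Pu; elim: s => //= i s; exact: P_D. Qed.

Lemma foldr_deriv_comm s i u : P u -> foldr D (D i u) s = D i (foldr D u s).
Proof.
by move=> Pu; elim: s => //= j s ->; rewrite D_comm //; exact: foldr_deriv_P.
Qed.

(** Raising an exponent inserts an index in the middle of the list of
    derivatives; commutation brings it to the end applied first. *)
Lemma foldr_deriv_perm s t u : P u -> perm_eq s t ->
  foldr D u s = foldr D u t.
Proof.
move=> Pu; elim: s t => [|i s IH] t; first by rewrite perm_sym => /perm_nilP ->.
move=> st; have it : i \in t by rewrite -(perm_mem st) mem_head.
have {}/IH /= -> : perm_eq s (rem i t).
  by rewrite -(perm_cons i) (perm_trans st) // perm_to_rem.
elim: t it {st} => //= j t IH; rewrite inE eq_sym; case: eqVneq => [-> //|_].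
by move=> /IH <- /=; rewrite D_comm //; exact: foldr_deriv_P.
Qed.

Lemma mderiv_P a u : P u -> P (mderiv a u).
Proof. exact: foldr_deriv_P. Qed.

Lemma mderiv_incr a i u : P u -> mderiv (incr a i) u = mderiv a (D i u).
Proof.
move=> Pu; rewrite /mderiv (foldr_deriv_perm Pu (exponents_incr a i)) /=.
by rewrite foldr_deriv_comm.
Qed.

Lemma mderiv_add a u v : P u -> P v ->
  mderiv a (u + v) = mderiv a u + mderiv a v.
Proof.
move=> Pu Pv; rewrite /mderiv; elim: exponents => //= i s ->.
by rewrite D_add //; exact: foldr_deriv_P.
Qed.

Lemma mderiv0 a u : (forall i, a i = 0%N) -> mderiv a u = u.
Proof.
move=> a0; rewrite /mderiv; suff -> : exponents a = [::] by [].
by rewrite /exponents; elim: (enum _) => //= i s ->; rewrite a0.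
Qed.

(** The algebraic form of repeated integration by parts, moving the derivatives
    from [v] to [u]. *)
Lemma leibniz_dual a u v : P u -> P v ->
  \sum_(b : below a) ((-1) ^+ deg (below_index b) *:
     mderiv (subm a (below_index b)) (mul (mderiv (below_index b) u) v)) *+
     multi_binomial a (below_index b) =
  mul u (mderiv a v).
Proof.
move=> + + /=; move: {2}(deg a) (erefl (deg a)) => m.
elim: m a u v => [|m IH] a u v am Pu Pv.
  have a0 i : a i = 0%N.
    by apply/eqP; rewrite -leqn0 -am /deg (bigD1 i) //= leq_addr.
  (* [below a] is now a singleton; the box with bound 0 makes this visible. *)
  pose F b := (-1) ^+ deg b *: mderiv (subm a b) (mul (mderiv b u) v).
  have a0' i : (a i <= 0)%N by rewrite a0.
  rewrite (sum_below_box F a0') (big_pred1 [ffun=> ord0]); last first.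
    by move=> b; apply/esym/eqP/ffunP => i; rewrite ffunE ord1.
  set z := of_box _.
  have z0 i : z i = 0%N by rewrite !ffunE.
  have -> : multi_binomial a z = 1%N.
    by rewrite /multi_binomial big1 // => i _; rewrite z0 bin0.
  rewrite mulr1n /F /deg big1 ?scale1r; last by move=> i _; rewrite z0.
  rewrite !mderiv0 // => i.
  by rewrite ffunE a0.
have [i ai] : exists i, (0 < a i)%N.
  apply/existsP; apply: contraT; rewrite negb_exists => /forallP a0.
  move: am; rewrite /deg big1 // => i _.
  by apply/eqP; rewrite -leqn0 leqNgt a0.
have [a' aE] : exists a', a = incr a' i by exists (decr a i); rewrite decrK.
have a'm : deg a' = m by move: am; rewrite aE deg_incr => -[].
rewrite aE mderiv_incr // -(IH a' u (D i v) a'm Pu (P_D _ Pv)).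
pose F b := (-1) ^+ deg b *:
  mderiv (subm (incr a' i) b) (mul (mderiv b u) v).
rewrite (sum_below_incr F).
apply: eq_bigr => b _; congr (_ *+ _); rewrite /F.
set c := below_index b.
have -> : subm (incr a' i) c = incr (subm a' c) i.
  apply/ffunP => j; rewrite !ffunE addnBAC //.
  by rewrite -ltnS.
have -> : subm (incr a' i) (incr c i) = subm a' c.
  by apply/ffunP => j; rewrite !ffunE subnDr.
(* What remains is the derivative [D i] of a product minus the term in which
   it falls on [mderiv c u], hence the term in which it falls on [v]. *)
have Pc := mderiv_P c Pu.
rewrite deg_incr exprS mulN1r scaleNr -scalerBr; congr (_ *: _).
rewrite !mderiv_incr //; last exact: P_mul.
rewrite D_mul // mderiv_add; last 2 first.
- by apply: P_mul => //; exact: P_D.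
- by apply: P_mul => //; exact: P_D.
by rewrite -foldr_deriv_comm // -/(mderiv c _) addrAC subrr add0r.
Qed.

End CommutingDerivations.

(** * Partial derivatives on an open set *)

Section PartialOn.
Context {R : realType} {n : nat} (O : set 'rV[R]_n).
Hypothesis oO : open O.
Implicit Types (g h : cfun R n).

(** [partial_on] cuts off once, after all derivatives have been taken, and
    [cderiv] after each of them; on an open set the two agree. *)
Lemma partial_onE (a : multi_index n) g : smooth_fun O g ->
  partial_on O a g = mderiv (fun i => cderiv O (delta_mx 0 i)) a g.
Proof.
move=> sg.
have dE : directions a = [seq delta_mx 0 i | i <- exponents a] :> seq 'rV[R]_n.
  rewrite /directions /exponents map_flatten -[in RHS]map_comp; congr flatten.
  by apply: eq_map => i /=; rewrite map_nseq.
rewrite /partial_on /partial dE /mderiv; elim: exponents => [|i s IH] /=.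
  apply/funext => x; rewrite patchE; case: ifPn => [_|].
    by case: (g x).
  by rewrite notin_setE => /sg.2 ->.
apply/funext => x; have [Ox|Ox] := pselect (O x); last first.
  by rewrite cderiv_out // patchC // inE.
rewrite cderivE // patchT ?inE //.
have nO : nbhs x O by exact: open_nbhs_nbhs.
by congr (_ +i* _)%C; apply: near_eq_derive; apply: filterS nO => y Oy;
  rewrite -IH patchT ?inE.
Qed.

(** The cut-off of [g] may be irregular at the boundary of [O], but on [O]
    itself its derivatives are those of [g]. *)
Lemma partial_on_restrict (a : multi_index n) g :
  partial_on O a (g \_ O) = (partial a g) \_ O.
Proof.
apply/funext => x; rewrite /partial_on !patchE; case: ifPn => //.
rewrite inE => Ox; rewrite /partial; congr (_ +i* _)%C.
- by apply: (eq_diter oO) => // y Oy; rewrite patchT ?inE.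
- by apply: (eq_diter oO) => // y Oy; rewrite patchT ?inE.
Qed.

Lemma leibniz_dual_partial_on (a : multi_index n) g h :
  smooth_fun O g -> smooth_fun O h ->
  (fun x => g x * partial_on O a h x : R[i]^o) =
  \sum_(b : below a)
    ((multi_binomial a (below_index b))%:R * (-1) ^+ deg (below_index b)) *:
      partial_on O (below_compl b)
        (fun x => partial_on O (below_index b) g x * h x) :> cfun R n.
Proof.
move=> sg sh.
have sD i u : smooth_fun O u -> smooth_fun O (cderiv O (delta_mx 0 i) u).
  exact: smooth_fun_cderiv.
have sM u v : smooth_fun O u -> smooth_fun O v ->
  smooth_fun O ((fun x => u x * v x) : cfun R n) by exact: smooth_funM.
have DA i u v : smooth_fun O u -> smooth_fun O v ->
  cderiv O (delta_mx 0 i) (u + v) = cderiv O (delta_mx 0 i) u +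
    cderiv O (delta_mx 0 i) v by exact: cderivD.
have DM i := @cderivM R n O (delta_mx 0 i).
have DC i j u (su : smooth_fun O u) :=
  cderivC oO (delta_mx 0 i) (delta_mx 0 j) su.
have := leibniz_dual sD sM DA DM DC a sg sh.
rewrite -partial_onE // => <-.
apply: eq_bigr => b _; rewrite -scaler_nat scalerA (partial_onE _ sg).
rewrite partial_onE; last by apply: sM => //; exact: (mderiv_P sD).
have -> // : below_compl b = subm a (below_index b).
by apply/ffunP => i; rewrite !ffunE.
Qed.

End PartialOn.

(** * Thick derivatives *)

Lemma deg_below {n : nat} (a : multi_index n) (b : below a) :
  (deg (below_compl b) + deg (below_index b))%N = deg a.
Proof.
rewrite /deg -big_split /=; apply: eq_bigr => i _.
by rewrite !ffunE subnK // -ltnS.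
Qed.

Theorem proposition4p3 (R : realType) (n d : nat) (S : tube_data R n d)
    (hS : tubular S) (Omega : set 'rV[R]_n) (hOmega : open Omega)
    (hmeet : Omega `&` Sigma S !=set0)
    (f : cfun R n -> R[i]^o) (hf : thick_dual S Omega f)
    (alpha : multi_index n) :
  dist_eq Omega (Pi S Omega (thick_deriv S Omega alpha f))
                (dist_deriv alpha (Pi S Omega f)) /\
  (forall psi : cfun R n, thick_mult S Omega psi ->
    thick_eq S Omega
      (thick_deriv S Omega alpha (thick_mul psi f))
      (\sum_(b : below alpha)
        (multi_binomial alpha (below_index b))%:R *:
        thick_mul (partial_on (Omega `\` Sigma S) (below_index b) psi)
          (thick_deriv S Omega (below_compl b) f))).
Proof.
have oO : open (Omega `\` Sigma S).
  rewrite setDE; apply: openI => //.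
  by apply: closed_openC; exact: tubular_closed hS.
split=> [phi _|psi [spsi _] phi [m [K [_ [sphi _ _]]]]].
  by rewrite /Pi /thick_deriv /dist_deriv partial_on_restrict.
have flin := hf.1.
pose F : {linear cfun R n -> R[i]^o} :=
  HB.pack f (GRing.isLinear.Build _ _ _ _ f flin).
rewrite /thick_deriv {1}/thick_mul (leibniz_dual_partial_on oO alpha spsi sphi).
rewrite -[f]/(F : _ -> _) linear_sum mulr_sumr fct_sumE.
apply: eq_bigr => b _; rewrite linearZ /=.
rewrite -(deg_below b) exprD /thick_mul.
set M : R[i] := _%:R; set s := (-1) ^+ deg (below_compl b).
set t := (-1) ^+ deg (below_index b); set y := f _.
have tt : t * t = 1 by rewrite -expr2 sqrr_sign.
change (s * t * (M * t * y) = M * (s * y)).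
by rewrite -[RHS]mulr1 -tt; ring.
Qed.
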